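(* Let $\Omega$ be a measurable space and let $\mu,\nu$ be probability measures on $\Omega$. The relative entropy $d_I$ and the $\chi^2$-distance $d_{\chi^2}$ satisfy $$d_I(\mu,\nu)\le\log\bigl[1+d_{\chi^2}(\mu,\nu)\bigr].$$ In particular, $d_I(\mu,\nu)\le d_{\chi^2}(\mu,\nu)$.
   Context: Let $f,g$ be the densities of $\mu,\nu$ respectively with respect to a $\sigma$-finite dominating measure $\lambda$ (e.g. $\lambda=(\mu+\nu)/2$), and let $S(\mu)=\{f>0\}$, $S(\nu)=\{g>0\}$ denote the supports. Define $$d_I(\mu,\nu)=\int_{S(\mu)}f\log(f/g)\,d\lambda,\qquad d_{\chi^2}(\mu,\nu)=\int_{S(\mu)\cup S(\nu)}\frac{(f-g)^2}{g}\,d\lambda.$$ Both are independent of the choice of $\lambda$ and take values in $[0,\infty]$. Here $\log$ is the natural logarithm, with conventions $0\log\frac{0}{q}=0$ and $p\log\frac{p}{0}=\infty$ for $p>0$; likewise $(f-g)^2/g=\infty$ at points where $g=0<f$, and $\log(1+\infty)=\infty$. *)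

(* Defs.v *)
From HB Require Import structures.
From mathcomp Require Import all_boot all_order all_algebra.
From mathcomp Require Import all_classical all_reals all_analysis.
Set Implicit Arguments.
Unset Strict Implicit.
Unset Printing Implicit Defensive.
Import Order.TTheory GRing.Theory Num.Theory.
Import numFieldNormedType.Exports.

Local Open Scope classical_set_scope.
Local Open Scope ring_scope.
Local Open Scope ereal_scope.

(* The last clause forces mu to be absolutely continuous with respect to
   lambda, so lambda dominates every measure having such a density. *)
Definition is_density d (T : measurableType d) (R : realType)
    (lambda : {measure set T -> \bar R}) (mu : set T -> \bar R)
    (f : T -> R) : Prop :=
  [/\ measurable_fun [set: T] f,
      (forall x, 0 <= f x)%R &
      forall A, measurable A -> mu A = \int[lambda]_(x in A) (f x)%:E].

Definition dens_support (T : Type) (R : realType) (f : T -> R) : set T :=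
  [set x | (0 < f x)%R].

(* Division and logarithm are those of \bar R: 0^-1 = +oo and lne +oo = +oo,
   so p * lne (p / 0) = +oo for p > 0.  The negative part of the integrand has
   integral at most the mass of nu when g is a density of nu, so the integral
   is never of the form +oo - +oo. *)
Definition relative_entropy d (T : measurableType d) (R : realType)
    (lambda : {measure set T -> \bar R}) (f g : T -> R) : \bar R :=
  \int[lambda]_(x in dens_support f) ((f x)%:E * lne ((f x)%:E / (g x)%:E)).

(* Since 0^-1 = +oo in \bar R, the integrand is +oo where g x = 0 < f x. *)
Definition chi2_dist d (T : measurableType d) (R : realType)
    (lambda : {measure set T -> \bar R}) (f g : T -> R) : \bar R :=
  \int[lambda]_(x in dens_support f `|` dens_support g)
    (((f x - g x) ^+ 2)%R%:E / (g x)%:E).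

(* Main.v *)
Require Import Defs.
From HB Require Import structures.
From mathcomp Require Import all_boot all_order all_algebra.
From mathcomp Require Import all_classical all_reals all_analysis.
From mathcomp Require Import measurable_realfun.
From mathcomp Require Import ring.
Import Order.TTheory GRing.Theory Num.Theory.
Import numFieldNormedType.Exports.
Local Open Scope classical_set_scope.
Local Open Scope ring_scope.
Local Open Scope ereal_scope.

Set Implicit Arguments.
Unset Strict Implicit.

(** The inequality comes from a single pointwise bound.  Write [C] for the
    chi-square distance and assume it finite, the other case being trivial; put
    [c = 1 + C >= 1].  The tangent line bound [ln t <= t - 1] at
    [t = f / (g c)] gives, where [f] and [g] are positive,
      [f ln (f / g) <= f ln c + f^2 / (g c) - f].
    Since [f^2 / g = (f - g)^2 / g + 2 f - g], the right-hand side is a linear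
    combination of [f], [g] and the integrand of [C], and the bound persists on
    the whole union [D] of the two supports, in the extended reals
    ([entropy_integrand_le]).  Integrated over [D], where [f] and [g] have mass
    1, the right-hand side is [ln c - 1 + (C + 2 - 1) / c = ln c].

    This is Jensen's inequality for the logarithm with its tangent line made
    explicit.  The integral of the majorant is finite, and monotonicity of the
    integral ([le_integral_restrict]) requires nothing of the entropy integrand,
    whose integrability is not known beforehand.  The second inequality follows
    from [ln (1 + C) <= C]. *)

(** Monotonicity of the integral for arbitrary functions, the two domains being
    allowed to differ: the integral of a nonnegative function is a supremum over
    the simple functions below it, which needs no measurability. *)
Lemma le_integral_restrict d (T : measurableType d) (R : realType)
    (mu : {measure set T -> \bar R}) (A B : set T) (f g : T -> \bar R) :
  (forall x, (f \_ A) x <= (g \_ B) x) ->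
  \int[mu]_(x in A) f x <= \int[mu]_(x in B) g x.
Proof.
move=> fg.
have le_nn (u v : T -> \bar R) : (forall x, 0 <= u x) ->
    (forall x, u x <= v x) -> \int[mu]_x u x <= \int[mu]_x v x.
  move=> u0 uv; rewrite !ge0_integralTE//; last first.
    by move=> x; exact: le_trans (uv x).
  apply: ereal_sup_le => _ [h hu <-].
  by exists h => // x; exact: le_trans (hu x) (uv x).
rewrite (integral_mkcond A) (integral_mkcond B) integralE [leRHS]integralE leeB//.
- by apply: le_nn => // x; apply: (funepos_le (fun y _ => fg y)); rewrite inE.
- by apply: le_nn => // x; apply: (funeneg_le (fun y _ => fg y)); rewrite inE.
Qed.

Lemma measurable_invr (R : realType) :
  measurable_fun [set: R] (@GRing.inv R).
Proof.
(* Since 0^-1 = 0 in R, inversion vanishes outside the open set where it is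
   continuous. *)
rewrite (_ : @GRing.inv R = @GRing.inv R \_ [set r | r != 0%R]); last first.
  apply/funext => r; rewrite /patch; case: ifPn => // /negP.
  by rewrite inE/= => /negP; rewrite negbK => /eqP ->; rewrite invr0.
apply/(measurable_restrictT _ (open_measurable (@open_neq R 0%R))).
apply: open_continuous_measurable_fun; first exact: open_neq.
by apply/in_setP => r /= r0; exact: inv_continuous.
Qed.

Lemma measurable_inve d (T : measurableType d) (R : realType) (g : T -> R) :
  measurable_fun [set: T] g ->
  measurable_fun [set: T] (fun x => (g x)%:E^-1 : \bar R).
Proof.
move=> mg.
rewrite (_ : (fun x => _) =
  (fun x => if g x == 0%R then +oo else ((g x)^-1)%:E)); last first.
  by apply/funext => x; rewrite inver.
apply: measurable_fun_ifT => //; first exact: measurable_fun_eqr.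
by apply/measurable_EFinP; apply: measurableT_comp mg; exact: measurable_invr.
Qed.

Lemma measurable_dens_support d (T : measurableType d) (R : realType)
    (f : T -> R) : measurable_fun [set: T] f -> measurable (dens_support f).
Proof.
move=> mf.
rewrite (_ : dens_support f = [set: T] `&` f @^-1` `]0%R, +oo[).
  exact: mf.
by apply/seteqP; split=> x /=; rewrite in_itv/= andbT; [split|case].
Qed.

(** A density of a probability measure has mass 1 on any set outside of which it
    vanishes. *)
Lemma integral_density d (T : measurableType d) (R : realType)
    (lambda : {measure set T -> \bar R}) (mu : probability T R) (f : T -> R)
    (D : set T) : is_density lambda mu f -> dens_support f `<=` D ->
  \int[lambda]_(x in D) (f x)%:E = 1.
Proof.
move=> [mf f0 muE] fD.
rewrite -(probability_setT mu) muE// integral_mkcond.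
apply: eq_integral => x _; rewrite /patch; case: ifPn => // /negP xD.
apply/esym/eqP; rewrite eqe eq_le f0 leNgt andbT; apply/negP => fx.
by apply: xD; rewrite inE; exact: fD.
Qed.

Lemma integrable_density d (T : measurableType d) (R : realType)
    (lambda : {measure set T -> \bar R}) (mu : probability T R) (f : T -> R)
    (D : set T) : measurable D -> is_density lambda mu f ->
  dens_support f `<=` D -> lambda.-integrable D (EFin \o f).
Proof.
move=> mD hf fD; have [mf f0 _] := hf; apply/integrableP; split.
  exact/measurable_EFinP/measurable_funTS.
under eq_integral do rewrite /= ger0_norm//.
by rewrite (integral_density hf fD) ltry.
Qed.

(** The tangent line bound [p ln (p / q) <= p ln c + p^2 / (q c) - p], its
    right-hand side regrouped around [(p - q)^2 / q]. *)
Lemma entropy_tangent (R : realType) (c p q : R) :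
  (0 < c)%R -> (0 < p)%R -> (0 < q)%R ->
  (p * ln (p / q) <=
    p * (ln c - 1 + 2 / c) + q * (- c^-1) + (p - q) ^+ 2 / q * c^-1)%R.
Proof.
move=> c0 p0 q0.
have qc0 : (0 < q * c)%R by rewrite mulr_gt0.
have t0 : (0 < p / (q * c))%R by rewrite divr_gt0.
have -> : (p / q = c * (p / (q * c)))%R by field; rewrite !gt_eqF.
rewrite lnM ?posrE//.
have lnt : (ln (p / (q * c)) <= p / (q * c) - 1)%R.
  have := @le_ln1Dx R (p / (q * c) - 1); rewrite subrKC; apply.
  by rewrite ltrBrDl subrr.
apply: (@le_trans _ _ (p * (ln c + (p / (q * c) - 1)))%R).
  by rewrite ler_pM2l// lerD2l.
by rewrite le_eqVlt; apply/orP; left; apply/eqP; field; rewrite !gt_eqF.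
Qed.

(** [entropy_tangent] in the extended reals, as a comparison of the integrands of
    the two distances, each extended by 0 outside its domain of integration. *)
Lemma entropy_integrand_le (T : Type) (R : realType) (f g : T -> R) (c : R) :
  (0 < c)%R -> (forall x, 0 <= f x)%R -> (forall x, 0 <= g x)%R ->
  forall x,
  ((fun x => (f x)%:E * lne ((f x)%:E / (g x)%:E)) \_ (dens_support f)) x <=
  ((fun x => ((f x)%:E * (ln c - 1 + 2 / c)%:E + (g x)%:E * (- c^-1)%:E) +
      ((f x - g x) ^+ 2)%R%:E / (g x)%:E * c^-1%:E)
    \_ (dens_support f `|` dens_support g)) x.
Proof.
move=> c0 f0 g0 x; have ci0 : (0 < c^-1)%R by rewrite invr_gt0.
rewrite /patch in_setU; have [|/negP] := boolP (x \in dens_support f).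
  rewrite inE /dens_support/= => fx.
  have [gx|gx] := eqVneq (g x) 0%R.
    (* Both sides are +oo where g vanishes and f does not. *)
    rewrite gx inve0 subr0 !gt0_muley ?lte_fin ?exprn_gt0//.
    by rewrite gt0_mulye ?lte_fin// addey// leey.
  have {}gx : (0 < g x)%R by rewrite lt_neqAle eq_sym gx g0.
  rewrite inver gt_eqF// -EFinM lne_EFin ?divr_gt0// -!EFinM -!EFinD lee_fin.
  exact: entropy_tangent.
rewrite inE /dens_support/= => /negP; rewrite -leNgt => fx.
have -> : f x = 0%R by apply/eqP; rewrite eq_le fx f0.
case: ifPn => //; rewrite inE => gx.
rewrite inver gt_eqF// -!EFinM -!EFinD lee_fin.
by rewrite le_eqVlt; apply/orP; left; apply/eqP; field; rewrite !gt_eqF.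
Qed.

Lemma chi2_dist_ge0 d (T : measurableType d) (R : realType)
    (lambda : {measure set T -> \bar R}) (f g : T -> R) :
  (forall x, 0 <= g x)%R -> 0 <= chi2_dist lambda f g.
Proof.
move=> g0; apply: integral_ge0 => x _.
by rewrite mule_ge0 ?inve_ge0 ?lee_fin ?sqr_ge0.
Qed.

Lemma integrable_chi2 d (T : measurableType d) (R : realType)
    (lambda : {measure set T -> \bar R}) (f g : T -> R) :
  measurable_fun [set: T] f -> measurable_fun [set: T] g ->
  (forall x, 0 <= g x)%R -> chi2_dist lambda f g < +oo ->
  lambda.-integrable (dens_support f `|` dens_support g)
    (fun x => ((f x - g x) ^+ 2)%R%:E / (g x)%:E).
Proof.
move=> mf mg g0 fin; apply/integrableP; split.
  apply: measurable_funTS; apply: emeasurable_funM; last exact: measurable_inve.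
  by apply/measurable_EFinP; apply: measurable_funX; exact: measurable_funB.
under eq_integral do rewrite gee0_abs ?mule_ge0 ?inve_ge0 ?lee_fin ?sqr_ge0//.
exact: fin.
Qed.

Lemma relative_entropy_le_lne d (T : measurableType d) (R : realType)
    (mu nu : probability T R) (lambda : {measure set T -> \bar R})
    (f g : T -> R) :
  is_density lambda mu f -> is_density lambda nu g ->
  relative_entropy lambda f g <= lne (1 + chi2_dist lambda f g).
Proof.
move=> hf hg; have [mf f0 _] := hf; have [mg g0 _] := hg.
have := chi2_dist_ge0 lambda f g0.
have := integrable_chi2 (lambda := lambda) mf mg g0.
case EC : (chi2_dist lambda f g) => [C| |]// iq; last first.
  by move=> _; rewrite addey// leey.
rewrite lee_fin => C0.
have {}iq := iq (ltry _).
have c0 : (0 < 1 + C)%R by rewrite ltr_wpDr.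
rewrite -EFinD lne_EFin//; set c := (1 + C)%R in c0 *.
apply: le_trans (le_integral_restrict lambda
  (entropy_integrand_le c0 f0 g0)) _.
set D := (_ `|` _) in iq *.
have mD : measurable D by apply: measurableU; exact: measurable_dens_support.
have fD : dens_support f `<=` D by exact: subsetUl.
have gD : dens_support g `<=` D by exact: subsetUr.
have i_f := integrable_density mD hf fD.
have i_g := integrable_density mD hg gD.
rewrite integralD//=; last 2 first.
- by apply: integrableD => //; exact: integrableZr.
- exact: integrableZr.
rewrite integralD//=; [|exact: integrableZr..].
rewrite !integralZr//.
rewrite (integral_density hf fD).
rewrite (integral_density hg gD).
rewrite -/(chi2_dist lambda f g) EC !mul1e -!EFinM -!EFinD lee_fin.
(* It remains to see that (ln c - 1 + 2 / c) - 1 / c + C / c = ln c. *)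
have -> : C = (c - 1)%R by rewrite /c addrAC subrr add0r.
by rewrite le_eqVlt; apply/orP; left; apply/eqP; field; rewrite gt_eqF.
Qed.

Unset Implicit Arguments.

Theorem theorem5 (R : realType) (d : measure_display) (T : measurableType d)
    (mu nu : probability T R)
    (lambda : {sigma_finite_measure set T -> \bar R}) (f g : T -> R)
    (hf : is_density lambda mu f) (hg : is_density lambda nu g) :
  relative_entropy lambda f g <= lne (1 + chi2_dist lambda f g) /\
  relative_entropy lambda f g <= chi2_dist lambda f g.
Proof.
have le_lne := relative_entropy_le_lne hf hg.
split=> //; apply: le_trans le_lne _; apply: le_lne1Dx.
have [_ g0 _] := hg.
by apply: le_trans (chi2_dist_ge0 _ _ g0); rewrite lee_fin lerN10.
Qed.
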